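(* Let $G$ be a connected graph. Then the following hold, where in each item every graph whose invariant $\kappa_3$ or $\lambda_3$ appears is assumed to have at least $3$ vertices: (1) $\lambda_3(G)\leq \kappa_3(L(G))$. (2) $\lambda_3(L(G))\geq \frac{3}{2}\lambda_3(G)-2$. (3) $\kappa_3(L(L(G)))\geq \frac{3}{2}\kappa_3(G)-2$.
   Context: All graphs are undirected, finite and simple. $L(G)$ denotes the line graph of $G$. For a graph $G$ and a set $S\subseteq V(G)$ of at least two vertices, a tree connecting $S$ is a subgraph $T$ of $G$ that is a tree with $S\subseteq V(T)$. Two trees $T,T'$ connecting $S$ are internally disjoint if $E(T)\cap E(T')=\varnothing$ and $V(T)\cap V(T')=S$. Let $\kappa(S)$ be the maximum number of pairwise internally disjoint trees connecting $S$ in $G$, and $\lambda(S)$ the maximum number of pairwise edge-disjoint trees connecting $S$ in $G$. Then $\kappa_3(G)=\min\{\kappa(S) : S\subseteq V(G),\ |S|=3\}$ and $\lambda_3(G)=\min\{\lambda(S) : S\subseteq V(G),\ |S|=3\}$. *)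

(* Defs.v *)
From mathcomp Require Import all_boot.

Set Implicit Arguments.
Unset Strict Implicit.
Unset Printing Implicit Defensive.

Record sgraph := SGraph {
  vertex :> finType;
  adj : rel vertex;
  adj_sym : symmetric adj;
  adj_irr : irreflexive adj }.

Definition connected (G : sgraph) : Prop := forall x y : G, connect (@adj G) x y.

Definition edges (G : sgraph) : {set {set G}} :=
  [set [set p.1; p.2] | p : G * G & adj p.1 p.2].

Section LineGraph.
Variable G : sgraph.

Definition line_vertex : finType := {a : {set G} | a \in edges G}.

Definition line_adj (a b : line_vertex) : bool :=
  (a != b) && (val a :&: val b != set0).

Lemma line_adj_sym : symmetric line_adj.
Proof. by move=> a b; rewrite /line_adj eq_sym setIC. Qed.

Lemma line_adj_irr : irreflexive line_adj.
Proof. by move=> a; rewrite /line_adj eqxx. Qed.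

Definition line_graph : sgraph := SGraph line_adj_sym line_adj_irr.
End LineGraph.

(* A subgraph is encoded by its vertex set and its edge set. *)
Definition subgraph (G : sgraph) : finType := ({set G} * {set {set G}})%type.

Section Trees.
Variable G : sgraph.
Implicit Types (S : {set G}) (H : subgraph G) (F : {set subgraph G}).

Definition is_subgraph H : bool :=
  (H.2 \subset edges G) && [forall a in H.2, a \subset H.1].

Definition sub_adj H : rel G := [rel x y | [set x; y] \in H.2].

(* As the edges of a subgraph join its vertices, an H-path between two vertices
   of H stays in H. *)
Definition sub_connected H : bool :=
  (H.1 != set0) && [forall x in H.1, forall y in H.1, connect (sub_adj H) x y].

(* The bound on the length only serves decidability; see acyclicP. *)
Definition acyclic H : bool :=
  [forall k : 'I_#|G|.+1, forall c : k.-tuple G,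
     (2 < k) ==> ~~ ucycleb (sub_adj H) c].

Lemma acyclicP H :
  reflect (forall c : seq G, 2 < size c -> ~ ucycle (sub_adj H) c) (acyclic H).
Proof.
apply: (iffP forallP) => [acyH c c_gt2 ucyc | acyH k].
  have/andP[_ uniq_c] := ucyc.
  have c_le : size c < #|G|.+1 by rewrite ltnS -(card_uniqP uniq_c) max_card.
  have /forallP/(_ (in_tuple c))/implyP/(_ c_gt2)/negP := acyH (Ordinal c_le).
  by apply.
apply/forallP=> c; apply/implyP=> k_gt2; apply/negP.
by apply: acyH; rewrite size_tuple.
Qed.

Definition connecting_tree S H : bool :=
  [&& is_subgraph H, sub_connected H, acyclic H & S \subset H.1].

Definition edge_disjoint H1 H2 : bool := H1.2 :&: H2.2 == set0.

Definition internally_disjoint S H1 H2 : bool :=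
  edge_disjoint H1 H2 && (H1.1 :&: H2.1 == S).

(* For |S| >= 2 every tree connecting S has an edge, so pairwise disjoint trees
   are distinct, and a set of trees loses nothing over an indexed family. *)
Definition internally_disjoint_trees S F : bool :=
  [forall H in F, connecting_tree S H]
  && [forall H1 in F, forall H2 in F, (H1 != H2) ==> internally_disjoint S H1 H2].

Definition edge_disjoint_trees S F : bool :=
  [forall H in F, connecting_tree S H]
  && [forall H1 in F, forall H2 in F, (H1 != H2) ==> edge_disjoint H1 H2].

Definition kappa S : nat := \max_(F | internally_disjoint_trees S F) #|F|.

Definition lambda S : nat := \max_(F | edge_disjoint_trees S F) #|F|.

(* minn has no neutral element: the maximum of f serves as the initial value, so
   that this is the minimum of f as soon as G has three vertices; see min3P. *)
Definition min3 (f : {set G} -> nat) : nat :=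
  \big[minn / \max_(S : {set G} | #|S| == 3) f S]_(S : {set G} | #|S| == 3) f S.

Lemma min3P f : 2 < #|G| ->
  (exists2 S : {set G}, #|S| = 3 & min3 f = f S)
  /\ (forall S : {set G}, #|S| = 3 -> min3 f <= f S).
Proof.
move=> G_gt2.
have min3_le (S : {set G}) : #|S| = 3 -> min3 f <= f S.
  move=> /eqP S3; rewrite /min3; move: (\max_(_ | _) _) (mem_index_enum S) => d.
  elim: (index_enum _) => //= S' s IHs; rewrite inE big_cons.
  case/predU1P=> [<- | /IHs le_s]; first by rewrite S3 geq_minl.
  by case: ifP => // _; apply: leq_trans (geq_minr _ _) le_s.
split=> //.
have [S0 S03] : exists S : {set G}, #|S| == 3.
  exists [set x in take 3 (enum G)].
  rewrite cardsE (card_uniqP (take_uniq 3 (enum_uniq G))).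
  by rewrite size_takel // -cardE.
pose P m := (exists2 S : {set G}, #|S| = 3 & m = f S)
            \/ m = \max_(S : {set G} | #|S| == 3) f S.
have : P (min3 f).
  rewrite /min3; apply: big_ind; first by right.
    by move=> m n Pm Pn; rewrite /minn; case: ifP.
  by move=> S /eqP S3; left; exists S.
case=> // min3_max; exists S0; first exact/eqP.
apply/eqP; rewrite eqn_leq min3_le /=; last exact/eqP.
by rewrite min3_max (leq_bigmax_cond S0).
Qed.

End Trees.

Definition kappa3 (G : sgraph) : nat := min3 (@kappa G).
Definition lambda3 (G : sgraph) : nat := min3 (@lambda G).

(* Main.v *)
Require Import Defs.
From mathcomp Require Import all_boot all_order all_algebra.
From mathcomp Require Import zify lra.

(** (1) Three distinct edges have distinct representatives u1, u2, u3.  The edges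
    of a tree of G connecting these span a connected subgraph of L(G), to which
    each of the three given edges is attached at its representative; edge-disjoint
    trees of G yield internally disjoint trees of L(G).

    (2) With m = lambda3 G, every cut of G has at least m edges, and hence every
    cut of L(G) has at least 2(m - 1) edges.  If every cut separating terminals
    a, b, c has at least 2n edges, there are n + n/2 (rounded down) edge-disjoint
    connected subgraphs containing a, b and c.  Start with 2n edge-disjoint a-b
    paths and augment a flow out of c, unit by unit, towards the vertices of these
    paths: a path reached once becomes a tripod, and one reached twice is split
    into a c-a and a c-b path.  The augmentation only stops when the flow has
    value 2n.

    (3) Since kappa3 <= lambda3, this is (2) for G followed by (1) for L(G). *)

Set Implicit Arguments.
Unset Strict Implicit.
Unset Printing Implicit Defensive.

Import Order.TTheory GRing.Theory Num.Theory.

(** * Trees *)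

Lemma connect_invariant (T : finType) (r : rel T) (P : T -> Prop) x y :
  P x -> (forall u v, P u -> r u v -> P v) -> connect r x y -> P y.
Proof.
move=> Px Pr /connectP[p pth ->].
by elim: p x Px pth => //= z p IHp x Px /andP[/(Pr _ _ Px)]; apply: IHp.
Qed.

Definition edge_rel (V : finType) (E : {set {set V}}) : rel V :=
  fun x y => [set x; y] \in E.
Arguments edge_rel {V} E x y /.

Section EdgeRel.
Variable V : finType.
Implicit Types (E : {set {set V}}) (x y : V).

Lemma edge_rel_sym E : symmetric (edge_rel E).
Proof. by move=> x y; rewrite /= setUC. Qed.

Lemma connect_edgeC E : connect_sym (edge_rel E).
Proof. exact/sym_connect_sym/edge_rel_sym. Qed.

Lemma connect_edgeS E E' x y :
  E \subset E' -> connect (edge_rel E) x y -> connect (edge_rel E') x y.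
Proof.
by move=> /subsetP sEE'; apply: connect_sub => u v /= /sEE'; apply: connect1.
Qed.

(** The rest of the cycle leads from [y] through [z] back to [x], and each of its edges has an end
    other than [x] and [y]. *)
Lemma ucycle_bypass E x y z p : ucycle (edge_rel E) [:: x, y, z & p] ->
  connect (edge_rel (E :\ [set x; y])) x y.
Proof.
case/andP=> /= /and3P[_ yz zp]; rewrite !inE !negb_or -!andbA.
case/and5P=> _ xz xp yz' /and3P[yp _ _]; rewrite connect_edgeC.
apply: (@connect_trans _ _ z).
  apply: connect1; rewrite /= in_setD1 yz andbT.
  apply/eqP=> /setP/(_ z); rewrite !inE eqxx orbT => /esym/orP[] /eqP zE.
    by rewrite zE eqxx in xz.
  by rewrite zE eqxx in yz'.
have: forall s, s \in z :: p -> (s != x) && (s != y).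
  move=> s; rewrite inE => /predU1P[->|sp]; first by rewrite eq_sym xz eq_sym.
  by apply/andP; split; apply/eqP=> E1; move: xp yp; rewrite -E1 sp.
elim: p z zp {yz xz xp yz' yp} => [|t p IHp] z /= => [/andP[zx _]|/andP[zt tp]] zpN.
  apply: connect1; rewrite /= in_setD1 zx andbT.
  have /andP[zNx zNy] := zpN z (mem_head _ _).
  apply/eqP=> /setP/(_ z); rewrite !inE eqxx orTb => /esym/orP[]; exact/negP.
apply: (@connect_trans _ _ t); last first.
  by apply: IHp => // s sp; apply: zpN; rewrite inE sp orbT.
apply: connect1; rewrite /= in_setD1 zt andbT.
have /andP[zNx zNy] := zpN z (mem_head _ _).
apply/eqP=> /setP/(_ z); rewrite !inE eqxx orTb => /esym/orP[]; exact/negP.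
Qed.

End EdgeRel.

Section Trees.
Variable G : sgraph.
Implicit Types (S W : {set G}) (E : {set {set G}}).

Lemma edgesP (e : {set G}) :
  reflect (exists x y, adj x y /\ e = [set x; y]) (e \in edges G).
Proof.
apply: (iffP imsetP) => [[[x y]]|[x [y [xy ->]]]].
  by rewrite inE /= => xy ->; exists x, y.
by exists (x, y) => //; rewrite inE.
Qed.

Lemma in_edges (x y : G) : ([set x; y] \in edges G) = adj x y.
Proof.
apply/edgesP/idP => [[u [v [uv /setP E]]]|xy]; last by exists x, y.
have uNv : u != v by apply: contraTneq uv => ->; rewrite adj_irr.
have := E u; have := E v; rewrite !inE !eqxx ?orbT /=.
move=> /orP[] /eqP Ev /orP[] /eqP Eu; subst => //.
- by rewrite eqxx in uNv.
- by rewrite adj_sym.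
- by rewrite eqxx in uNv.
Qed.

(** A minimal subset of [E] that still connects [S], together with the vertices it reaches from a
    point of [S], is the tree: an edge outside this component or on a cycle could be removed without
    disconnecting [S]. *)
Lemma exists_tree S W E : S != set0 -> E \subset edges G ->
    (forall e, e \in E -> e \subset W) -> S \subset W ->
    {in S &, forall x y, connect (edge_rel E) x y} ->
  exists T : subgraph G, [/\ connecting_tree S T, T.1 \subset W & T.2 \subset E].
Proof.
case/set0Pn=> x0 Sx0 sEG sEW sSW conE.
pose P (A : {set {set G}}) :=
  [forall x in S, forall y in S, connect (edge_rel A) x y].
have conP A : reflect {in S &, forall x y, connect (edge_rel A) x y} (P A).
  apply: (iffP forall_inP) => [H x y Sx Sy|H x Sx].
    exact: (forall_inP (H x Sx)).
  by apply/forall_inP=> y Sy; apply: H.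
have [A /minsetP[/conP conA minA] sAE] : {A | minset P A & A \subset E}.
  by apply: minset_exists; apply/conP.
have noremove e : e \in A ->
    ~ {in S &, forall x y, connect (edge_rel (A :\ e)) x y}.
  move=> Ae /conP/minA/(_ (subD1set _ _)) E1.
  by move: Ae; rewrite -E1 !inE eqxx.
pose C := [set y | connect (edge_rel A) x0 y].
have sSC : S \subset C by apply/subsetP=> y Sy; rewrite inE conA.
have sAC e : e \in A -> e \subset C.
  move=> Ae; apply/negPn/negP=> eNC; case: (noremove e Ae).
  have xcon y : y \in S -> connect (edge_rel (A :\ e)) x0 y.
    move=> Sy; have := conA _ _ Sx0 Sy.
    apply: (connect_invariant (P := connect (edge_rel (A :\ e)) x0)) => [|u v xu /= Auv].
      exact: connect0.
    apply: (connect_trans xu); apply: connect1; rewrite /= in_setD1 Auv andbT.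
    apply: contraNneq eNC => <-.
    have Cu : connect (edge_rel A) x0 u by apply: connect_edgeS xu; exact: subD1set.
    apply/subsetP=> z; rewrite !inE => /orP[]/eqP-> //.
    by apply: (connect_trans Cu); apply: connect1.
  move=> x y Sx Sy; apply: (connect_trans _ (xcon y Sy)).
  by rewrite connect_edgeC xcon.
exists (C, A); split => //=; last first.
  apply/subsetP=> y; rewrite inE.
  apply: (connect_invariant (P := fun y => y \in W)); first exact: (subsetP sSW).
  move=> u v _ /(subsetP sAE)/sEW/subsetP; apply; by rewrite !inE eqxx orbT.
apply/and4P; split=> //=.
- apply/andP; split; first exact: subset_trans sEG.
  by apply/forall_inP=> e; apply: sAC.
- apply/andP; split; first by apply/set0Pn; exists x0; rewrite inE connect0.
  apply/forall_inP=> x /=; rewrite inE => x0x; apply/forall_inP=> y /=.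
  rewrite inE => x0y; apply: (connect_trans _ x0y).
  rewrite -/(edge_rel A); by rewrite connect_edgeC.
- apply/acyclicP=> -[|x [|y [|z p]]] // _ cyc.
  have [/= /andP[Axy _] /andP[]] := andP cyc.
  rewrite inE negb_or => /andP[xNy _] _.
  apply: (noremove [set x; y]) => // u v Su Sv.
  have := conA _ _ Su Sv; apply: connect_sub => s t /= Ast.
  have [E1|Nst] := eqVneq [set s; t] [set x; y]; last first.
    by apply: connect1; rewrite /= in_setD1 Nst.
  have xy : connect (edge_rel (A :\ [set x; y])) x y by apply: ucycle_bypass cyc.
  have := E1 => /setP E2; have := E2 x; have := E2 y.
  rewrite !inE !eqxx ?orbT /= => /orP[]/eqP ? /orP[]/eqP ?; subst => //.
  - by rewrite eqxx in xNy.
  - by rewrite connect_edgeC.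
  - by rewrite eqxx in xNy.
Qed.

End Trees.

(** * Packings of trees from disjoint connected subgraphs *)

Section TreePacking.
Variables (G : sgraph) (S : {set G}).
Hypothesis S_gt1 : 1 < #|S|.
Implicit Types (I : finType) (F : {set subgraph G}).

Lemma connecting_tree_edge T : connecting_tree S T -> T.2 != set0.
Proof.
case/and4P=> _ /andP[_ conT] _ /subsetP sST.
have [x [y [Sx Sy xNy]]] := card_gt1P S_gt1.
have /connectP[[|z p] /= pth yE] := forall_inP (forall_inP conT x (sST _ Sx)) y (sST _ Sy).
  by rewrite yE eqxx in xNy.
by apply/set0Pn; exists [set x; z]; case/andP: pth.
Qed.

(** A tree is chosen inside each of the given subgraphs. The choices differ because each tree has an
    edge, which lies in only one of the disjoint sets [E i]. *)
Lemma exists_trees I (A : {set I}) (W : I -> {set G}) (E : I -> {set {set G}}) :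
    {in A, forall i, [/\ E i \subset edges G, forall e, e \in E i -> e \subset W i,
       S \subset W i & {in S &, forall x y, connect (edge_rel (E i)) x y}]} ->
    {in A &, forall i j, i != j -> [disjoint E i & E j]} ->
  exists2 t : I -> subgraph G,
    {in A, forall i, [/\ connecting_tree S (t i), (t i).1 \subset W i & (t i).2 \subset E i]}
    & {in A &, injective t}.
Proof.
move=> treeA disA.
pose P i (T : subgraph G) := [&& connecting_tree S T, T.1 \subset W i & T.2 \subset E i].
(* For [i] in [A] the default is never taken, by [exists_tree]. *)
pose t i := odflt (set0, set0) [pick T | P i T].
have tP : {in A, forall i,
    [/\ connecting_tree S (t i), (t i).1 \subset W i & (t i).2 \subset E i]}.
  move=> i Ai; rewrite /t; case: pickP => [T /and3P //|noT].
  have [sEG sEW sSW conE] := treeA i Ai.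
  have S0 : S != set0 by rewrite -card_gt0 ltnW.
  by have [T [T1 T2 T3]] := exists_tree S0 sEG sEW sSW conE; have := noT T; rewrite /P T1 T2 T3.
exists t => // i j Ai Aj tij; apply/eqP/negPn/negP=> /(disA i j Ai Aj) dis.
have [treei _ sEi] := tP i Ai; have [_ _] := tP j Aj; rewrite -tij => sEj.
have /set0Pn[e te] := connecting_tree_edge treei.
by move/pred0P: dis => /(_ e) /=; rewrite (subsetP sEi) ?(subsetP sEj).
Qed.

(** Trees are cut out of the edge sets by [exists_trees], so a lower bound on [lambda] only takes
    disjoint edge sets that connect [S], cycles being allowed. *)
Lemma card_le_lambda I (A : {set I}) (E : I -> {set {set G}}) :
    {in A, forall i, E i \subset edges G} ->
    {in A, forall i, {in S &, forall x y, connect (edge_rel (E i)) x y}} ->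
    {in A &, forall i j, i != j -> [disjoint E i & E j]} ->
  #|A| <= lambda S.
Proof.
move=> sEG conE disE.
have [|t tP t_inj] := @exists_trees I A (fun=> setT) E _ disE.
  by move=> i Ai; split=> //; [exact: sEG | exact: conE].
rewrite -(card_in_imset t_inj).
apply: (leq_bigmax_cond (F := fun F : {set subgraph G} => #|F|)).
apply/andP; split.
  by apply/forall_inP=> _ /imsetP[i Ai ->]; case: (tP i Ai).
apply/forall_inP=> _ /imsetP[i Ai ->]; apply/forall_inP=> _ /imsetP[j Aj ->].
apply/implyP=> tN; have ij : i != j by apply: contraNneq tN => ->.
have [_ _ sEi] := tP i Ai; have [_ _ sEj] := tP j Aj.
rewrite /edge_disjoint setI_eq0; apply: disjointWl sEi _.
by apply: disjointWr sEj _; apply: disE.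
Qed.

(** Two of the trees share all of [S], and the sets [W i] around them share nothing else, so they
    meet exactly in [S]. *)
Lemma card_le_kappa I (A : {set I}) (W : I -> {set G}) (E : I -> {set {set G}}) :
    {in A, forall i, [/\ E i \subset edges G, forall e, e \in E i -> e \subset W i,
       S \subset W i & {in S &, forall x y, connect (edge_rel (E i)) x y}]} ->
    {in A &, forall i j, i != j -> [disjoint E i & E j]} ->
    {in A &, forall i j, i != j -> W i :&: W j \subset S} ->
  #|A| <= kappa S.
Proof.
move=> treeE disE disW; have [t tP t_inj] := exists_trees treeE disE.
rewrite -(card_in_imset t_inj).
apply: (leq_bigmax_cond (F := fun F : {set subgraph G} => #|F|)).
apply/andP; split.
  by apply/forall_inP=> _ /imsetP[i Ai ->]; case: (tP i Ai).
apply/forall_inP=> _ /imsetP[i Ai ->]; apply/forall_inP=> _ /imsetP[j Aj ->].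
apply/implyP=> tN; have ij : i != j by apply: contraNneq tN => ->.
have [/and4P[_ _ _ Si] sWi sEi] := tP i Ai.
have [/and4P[_ _ _ Sj] sWj sEj] := tP j Aj.
apply/andP; split.
  rewrite /edge_disjoint setI_eq0; apply: disjointWl sEi _.
  by apply: disjointWr sEj _; apply: disE.
by rewrite eqEsubset subsetI Si Sj !andbT (subset_trans (setISS sWi sWj)) ?disW.
Qed.

Lemma kappa_le_lambda : kappa S <= lambda S.
Proof.
apply/bigmax_leqP=> F /andP[treeF disF].
apply: (leq_bigmax_cond (F := fun F : {set subgraph G} => #|F|)).
rewrite /edge_disjoint_trees treeF.
apply/forall_inP=> T FT; apply/forall_inP=> T' FT'; apply/implyP=> TT'.
by have /forall_inP/(_ _ FT')/implyP/(_ TT')/andP[] := forall_inP disF T FT.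
Qed.

End TreePacking.

Lemma lambdaP (G : sgraph) (S : {set G}) :
  exists2 F : {set subgraph G}, edge_disjoint_trees S F & lambda S = #|F|.
Proof.
have [] := @eq_bigmax_cond _ (mem (edge_disjoint_trees S)) (fun F : {set subgraph G} => #|F|).
  apply/card_gt0P; exists set0; rewrite unfold_in; apply/andP; split.
    by apply/forall_inP=> T; rewrite inE.
  by apply/forall_inP=> T; rewrite inE.
by move=> F FP lE; exists F.
Qed.

Lemma kappa3_le_lambda3 (G : sgraph) : 2 < #|G| -> kappa3 G <= lambda3 G.
Proof.
move=> G_gt2; have [[S S3 lE] _] := min3P (@lambda G) G_gt2.
have [_ /(_ S S3) kle] := min3P (@kappa G) G_gt2.
by rewrite /lambda3 lE; apply: leq_trans kle (kappa_le_lambda _).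
Qed.

Lemma edge_card2 (G : sgraph) (e : {set G}) : e \in edges G -> #|e| = 2.
Proof.
case/edgesP=> x [y [xy ->]]; rewrite cards2.
by case: eqVneq xy => // ->; rewrite adj_irr.
Qed.

Lemma edge_pairP (G : sgraph) (e : {set G}) x y :
  e \in edges G -> x \in e -> y \in e -> x != y -> e = [set x; y].
Proof.
move=> /edge_card2 e2 ex ey xy; apply/esym/eqP.
by rewrite eqEcard e2 cards2 xy andbT; apply/subsetP=> z; rewrite !inE => /orP[]/eqP->.
Qed.

(** Choose [u1] in [e1] outside [e2], then [u3] in [e3] other than [u1], then [u2] in [e2] other
    than [u3]; it differs from [u1], which is not on [e2]. *)
Lemma exists_representatives (G : sgraph) (e1 e2 e3 : {set G}) :
    e1 \in edges G -> e2 \in edges G -> e3 \in edges G -> e1 != e2 ->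
  exists u1 u2 u3, [/\ u1 \in e1, u2 \in e2, u3 \in e3 & uniq [:: u1; u2; u3]].
Proof.
move=> Ee1 Ee2 Ee3 e12.
have /subsetPn[u1 e1u1 e2u1] : ~~ (e1 \subset e2).
  apply: contraNN e12 => s12.
  by rewrite eqEcard s12 (edge_card2 Ee1) (edge_card2 Ee2).
have pick_other (e : {set G}) u : e \in edges G -> exists2 v, v \in e & v != u.
  move=> /edge_card2 e2'; have /card_gt0P[v] : 0 < #|e :\ u|.
    by have := cardsD1 u e; rewrite e2'; case: (u \in e) => /= ?; lia.
  by rewrite !inE => /andP[vu ev]; exists v.
have [u3 e3u3 u31] := pick_other e3 u1 Ee3.
have [u2 e2u2 u23] := pick_other e2 u3 Ee2.
exists u1, u2, u3; split=> //=; rewrite !inE negb_or andbT u23 andbT eq_sym.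
rewrite [u1 == u3]eq_sym u31 andbT.
by apply: contraNneq e2u1 => <-.
Qed.

(** * Line graphs *)

Section LineTrees.
Variables (G : sgraph) (S : {set line_graph G}) (u : line_graph G -> G).
Hypothesis S_gt1 : 1 < #|S|.
Hypothesis u_in : {in S, forall e, u e \in val e}.
Hypothesis u_inj : {in S &, injective u}.
Implicit Types (T : subgraph G) (e f g h : line_graph G).

Definition tree_line_vertices T : {set line_graph G} := [set f | val f \in T.2].

(** The image of [T] in the line graph: adjacent edges of [T] are joined, and a terminal [f] is
    attached to the edges of [T] at its representative [u f]. *)
Definition line_tree_edges T : {set {set line_graph G}} :=
  [set [set p.1; p.2] | p : line_graph G * line_graph G &
     [&& adj p.1 p.2, p.2 \in tree_line_vertices T &
      (p.1 \in tree_line_vertices T) || (p.1 \in S) && (u p.1 \in val p.2)]].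

Lemma line_tree_edgesP T (a : {set line_graph G}) :
  reflect (exists f h, [/\ adj f h, h \in tree_line_vertices T,
             (f \in tree_line_vertices T) || (f \in S) && (u f \in val h)
             & a = [set f; h]])
          (a \in line_tree_edges T).
Proof.
apply: (iffP imsetP) => [[[f h]]|[f [h [fh Th fT ->]]]].
  by rewrite inE => /and3P[] /= ? ? ? ->; exists f, h.
by exists (f, h) => //; rewrite inE; apply/and3P.
Qed.

Lemma line_adjI f g x : x \in val f -> x \in val g -> f != g -> adj f g.
Proof.
by move=> fx gx fg; apply/andP; split=> //; apply/set0Pn; exists x; rewrite inE fx.
Qed.

Section OneTree.
Variable T : subgraph G.
Hypothesis treeT : connecting_tree (u @: S) T.

Let T_edges (a : {set G}) : a \in T.2 -> a \in edges G.
Proof. by case/and4P: treeT => /andP[/subsetP sub _] _ _ _; apply: sub. Qed.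

Let T_connect x y : x \in u @: S -> y \in u @: S -> connect (sub_adj T) x y.
Proof.
case/and4P: treeT => _ /andP[_ conT] _ /subsetP sST Sx Sy.
exact: (forall_inP (forall_inP conT x (sST _ Sx)) y (sST _ Sy)).
Qed.

Lemma line_tree_edges_sub : line_tree_edges T \subset edges (line_graph G).
Proof.
by apply/subsetP=> a /line_tree_edgesP[f [h [fh _ _ ->]]]; rewrite in_edges.
Qed.

Lemma line_tree_edges_in a :
  a \in line_tree_edges T -> a \subset S :|: tree_line_vertices T.
Proof.
case/line_tree_edgesP=> f [h [_ Th fT ->]]; apply/subsetP=> g; rewrite in_set2 in_setU.
case/orP=> /eqP->; last by rewrite Th orbT.
by case/orP: fT => [->|/andP[-> _]]; rewrite ?orbT.
Qed.

Lemma line_tree_edges_meet x f g :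
    f \in tree_line_vertices T -> g \in tree_line_vertices T ->
    x \in val f -> x \in val g -> connect (edge_rel (line_tree_edges T)) f g.
Proof.
move=> Tf Tg fx gx; have [->|fg] := eqVneq f g; first exact: connect0.
apply: connect1; apply/line_tree_edgesP; exists f, g; split=> //.
  exact: line_adjI fx gx fg.
by rewrite Tf.
Qed.

(** Consecutive edges of a walk in [T] share a vertex, hence are equal or adjacent in the line
    graph. *)
Lemma line_tree_edges_path x p f g :
    path (sub_adj T) x p -> f \in tree_line_vertices T -> x \in val f ->
    g \in tree_line_vertices T -> last x p \in val g ->
  connect (edge_rel (line_tree_edges T)) f g.
Proof.
elim: p x f => [|y p IHp] x f /=; first by move=> _ Tf fx Tg; apply: line_tree_edges_meet.
case/andP=> Txy pth Tf fx Tg gy.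
have Exy := T_edges Txy.
pose h : line_graph G := Sub [set x; y] Exy.
have Th : h \in tree_line_vertices T by rewrite inE.
apply: (@connect_trans _ _ h).
  by apply: (line_tree_edges_meet (x := x)) => //; rewrite /= !inE eqxx.
by apply: IHp pth _ _ _ _ => //; rewrite /= !inE eqxx orbT.
Qed.

(** Another terminal [e'] has another representative, so the walk in [T] from [u e] to [u e'] has a
    first edge [h]; it contains [u e] and is [e] or a neighbour of [e]. *)
Lemma line_tree_edges_attach e : e \in S ->
  exists h, [/\ h \in tree_line_vertices T, u e \in val h
    & connect (edge_rel (line_tree_edges T)) e h].
Proof.
move=> Se; have [e' Se' ee'] : exists2 e', e' \in S & e' != e.
  have /card_gt0P[e'] : 0 < #|S :\ e| by have := cardsD1 e S; rewrite Se; move: S_gt1; lia.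
  by rewrite !inE => /andP[]; exists e'.
have /connectP[[|y p] /= pth uE] := T_connect (imset_f u Se) (imset_f u Se').
  by move: ee'; rewrite (u_inj Se' Se uE) eqxx.
case/andP: pth => Txy _; pose h : line_graph G := Sub [set u e; y] (T_edges Txy).
have Th : h \in tree_line_vertices T by rewrite inE.
have hu : u e \in val h by rewrite /= !inE eqxx.
exists h; split=> //; have [<-|eh] := eqVneq e h; first exact: connect0.
apply: connect1; apply/line_tree_edgesP; exists e, h; split=> //.
  exact: line_adjI (u_in Se) hu eh.
by rewrite Se hu orbT.
Qed.

Lemma line_tree_edges_connect :
  {in S &, forall e e', connect (edge_rel (line_tree_edges T)) e e'}.
Proof.
move=> e e' Se Se'.
have [h [Th hu eh]] := line_tree_edges_attach Se.
have [h' [Th' hu' eh']] := line_tree_edges_attach Se'.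
have /connectP[p pth uE] := T_connect (imset_f u Se) (imset_f u Se').
apply: (connect_trans eh); rewrite connect_edgeC; apply: (connect_trans eh').
by rewrite connect_edgeC; apply: line_tree_edges_path pth _ _ _ _; rewrite -?uE.
Qed.

End OneTree.

(* An edge of L(G) used by the images of two disjoint trees would join two
   members f, h of S, with f in one tree, h in the other, u f on h and u h on f;
   then f and h would have the same two ends. *)
Lemma line_tree_edges_disjoint T T' :
  edge_disjoint T T' -> [disjoint line_tree_edges T & line_tree_edges T'].
Proof.
move=> /eqP TT'.
have notboth f : f \in tree_line_vertices T -> f \in tree_line_vertices T' -> False.
  by rewrite !inE => Tf T'f; have /setP/(_ (val f)) := TT'; rewrite !inE Tf T'f.
apply/pred0P=> a /=; apply/negP=> /andP[].
case/line_tree_edgesP=> f [h [fh Th fT ->]] /line_tree_edgesP[f' [h' [fh' Th' fT' E]]].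
(* As [h] and [h'] lie in different trees, the common edge is matched crosswise: [h] is [f'] and [f]
   is [h']. *)
have hh' : h != h' by apply/eqP=> hh'; case: (notboth h); rewrite // hh'.
have /eqP hf' : h == f'.
  by have /setP/(_ h) := E; rewrite !inE eqxx orbT (negPf hh') orbF => <-.
have /eqP fh1 : f == h'.
  by have /setP/(_ h') := E; rewrite !inE eqxx orbT [h' == h]eq_sym (negPf hh') orbF eq_sym.
subst f' h'; case/orP: fT => [/notboth/(_ Th')//|/andP[Sf uf]].
case/orP: fT' => [/(notboth _ Th)//|/andP[Sh uh]].
have ufh : u f != u h.
  by apply: contraTneq fh => /(u_inj Sf Sh)->; rewrite adj_irr.
have fhE : val f = val h.
  rewrite (edge_pairP (valP f) (u_in Sf) uh ufh).
  by rewrite (edge_pairP (valP h) uf (u_in Sh) ufh).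
by move: fh; rewrite (val_inj fhE) adj_irr.
Qed.

(** A tree on the representatives gives a subgraph whose vertices are [S] and the edges of the tree;
    for edge-disjoint trees these vertex sets meet only in [S]. *)
Lemma lambda_le_kappa_line : lambda (u @: S) <= kappa S.
Proof.
have [F /andP[/forall_inP treeF /forall_inP disF] ->] := lambdaP (u @: S).
have disjF : {in F &, forall T T', T != T' -> edge_disjoint T T'}.
  by move=> T T' FT FT'; apply/implyP; apply: (forall_inP (disF T FT)).
apply: (@card_le_kappa _ _ S_gt1 _ F (fun T => S :|: tree_line_vertices T)
  line_tree_edges).
- move=> T /treeF treeT; split; first exact: line_tree_edges_sub.
  + exact: line_tree_edges_in.
  + exact: subsetUl.
  + exact: line_tree_edges_connect.
- by move=> T T' FT FT' TT'; apply/line_tree_edges_disjoint/disjF.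
move=> T T' FT FT' /(disjF _ _ FT FT')/eqP/setP dis.
apply/subsetP=> f; rewrite !inE; have := dis (val f); rewrite !inE.
by case: (f \in S) => //= ->.
Qed.

End LineTrees.

Lemma cards3P (T : finType) (S : {set T}) : #|S| = 3 ->
  exists a b c, S = [set a; b; c] /\ uniq [:: a; b; c].
Proof.
move=> S3; have := enum_uniq S; have : size (enum S) = 3 by rewrite -cardE.
case E: (enum S) => [|a [|b [|c [|d s]]]] // _ abc; exists a, b, c; split=> //.
by apply/setP=> x; rewrite -mem_enum E !inE orbA.
Qed.

Lemma lambda3_le_kappa3_line (G : sgraph) :
  2 < #|G| -> 2 < #|line_graph G| -> lambda3 G <= kappa3 (line_graph G).
Proof.
move=> G_gt2 L_gt2; have [[S S3 kE] _] := min3P (@kappa (line_graph G)) L_gt2.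
have [_ lle] := min3P (@lambda G) G_gt2.
rewrite /kappa3 kE.
have [e1 [e2 [e3 [SE /and4P[]]]]] := cards3P S3.
rewrite !inE negb_or => /andP[e12 e13] e23 _ _.
have [u1 [u2 [u3 [e1u e2u e3u uu]]]] :=
  exists_representatives (valP e1) (valP e2) (valP e3) e12.
pose u e := if e == e1 then u1 else if e == e2 then u2 else u3.
have uE1 : u e1 = u1 by rewrite /u eqxx.
have uE2 : u e2 = u2 by rewrite /u eqxx eq_sym (negPf e12).
have uE3 : u e3 = u3 by rewrite /u eq_sym (negPf e13) eq_sym (negPf e23).
have u_in : {in S, forall e, u e \in val e}.
  move=> e; rewrite SE !inE => /orP[/orP[]|] /eqP->; by rewrite ?uE1 ?uE2 ?uE3.
have u_inj : {in S &, injective u}.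
  move: uu; rewrite /= !inE negb_or andbT => /andP[/andP[/negPf u12 /negPf u13] /negPf u23].
  move=> e e'; rewrite SE !inE => /orP[/orP[]|] /eqP-> /orP[/orP[]|] /eqP->;
    rewrite ?uE1 ?uE2 ?uE3 // => /eqP; rewrite ?u12 ?u13 ?u23 //;
    by rewrite eq_sym ?u12 ?u13 ?u23.
apply: leq_trans (lle (u @: S) _) _; first by rewrite card_in_imset.
by apply: lambda_le_kappa_line; rewrite ?S3.
Qed.

(** * Flows *)

Section Flows.
Variable V : finType.
Implicit Types (E : {set {set V}}) (R : {set V}) (f : V -> V -> int).
Local Open Scope ring_scope.

(** Net flow out of [v]: positive at sources, negative at sinks. *)
Definition excess f v : int := \sum_u f v u.

(** Integer flows in an undirected graph with unit capacities; by antisymmetry the values are -1, 0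
    and 1. *)
Definition is_flow E f := forall u v,
  [/\ f u v = - f v u, f u v <= 1 & f u v != 0 -> [set u; v] \in E].

(** Pairs directed out of [R] count each edge of the cut once. *)
Definition cut_arcs E R : {set V * V} :=
  [set p | [&& p.1 \in R, p.2 \notin R & [set p.1; p.2] \in E]].

Definition path_edges x p : seq {set V} := pairmap (fun u v => [set u; v]) x p.

Fixpoint path_flow (x : V) (p : seq V) (u v : V) : int :=
  if p is y :: p' then
    ((u == x) && (v == y))%:Z - ((u == y) && (v == x))%:Z + path_flow y p' u v
  else 0.

Lemma sum_delta (x : V) : \sum_v (v == x)%:Z = 1 :> int.
Proof. by rewrite (bigD1 x) //= eqxx big1 ?addr0 // => v /negPf->. Qed.

Lemma path_flow_anti x p u v : path_flow x p u v = - path_flow x p v u.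
Proof.
elim: p x => [|y p IHp] x /=; first by rewrite oppr0.
rewrite IHp [(v == x) && _]andbC [(v == y) && _]andbC; lia.
Qed.

Lemma excess_path_flow x p v :
  excess (path_flow x p) v = (v == x)%:Z - (v == last x p)%:Z.
Proof.
elim: p x => [|y p IHp] x; rewrite /excess /=; first by rewrite big1 // subrr.
rewrite big_split /= -/(excess _ v) IHp big_split /=.
have sum1 (a b : V) : \sum_u ((v == a) && (u == b))%:Z = (v == a)%:Z :> int.
  by case: (v == a) => /=; [rewrite sum_delta | rewrite big1].
by rewrite sumrN !sum1 addrA subrK.
Qed.

Lemma path_flow_out x p u v : (u \notin x :: p) || (v \notin x :: p) ->
  path_flow x p u v = 0.
Proof.
elim: p x => //= y p IHp x out; rewrite IHp ?addr0; last first.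
  by move: out; rewrite !in_cons !negb_or; case/orP=> /andP[_ ->]; rewrite ?orbT.
move: out; rewrite !in_cons !negb_or.
by case/orP=> /and3P[/negPf-> /negPf-> _]; rewrite ?andbF.
Qed.

(** On a simple path the first edge is not met again, so the sum of contributions becomes a case
    distinction. *)
Lemma path_flow_cons x y p u v : uniq [:: x, y & p] ->
  path_flow x (y :: p) u v =
    if (u == x) && (v == y) then 1 else if (u == y) && (v == x) then - 1
    else path_flow y p u v.
Proof.
move=> /andP[xp _] /=; have xy : x != y by apply: contraNneq xp => ->; apply: mem_head.
case: ifP => [/andP[/eqP-> /eqP->]|_].
  by rewrite (negPf xy) path_flow_out ?xp //.
case: ifP => [/andP[/eqP-> /eqP->]|_]; last by rewrite subr0 add0r.
by rewrite path_flow_out ?xp ?orbT //.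
Qed.

Lemma path_flow_le1 x p u v : uniq (x :: p) -> path_flow x p u v <= 1.
Proof.
elim: p x => // y p IHp x uniq_p; rewrite path_flow_cons //.
by case: ifP => // _; case: ifP => // _; apply: IHp; case/andP: uniq_p.
Qed.

Lemma path_flow_gt0 (r : rel V) x p u v : path r x p -> uniq (x :: p) ->
  0 < path_flow x p u v -> r u v.
Proof.
elim: p x => // y p IHp x /andP[rxy pth] uniq_p; rewrite path_flow_cons //.
case: ifP => [/andP[/eqP-> /eqP->] //|_]; case: ifP => // _.
by apply: IHp => //; case/andP: uniq_p.
Qed.

Lemma path_flow_neq0 x p u v : uniq (x :: p) ->
  (path_flow x p u v != 0) = ([set u; v] \in path_edges x p).
Proof.
elim: p x => // y p IHp x uniq_p; rewrite path_flow_cons //= in_cons.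
have [xp uniq_p'] := andP uniq_p.
have xy : x != y by apply: contraNneq xp => ->; apply: mem_head.
case: ifP => [/andP[/eqP-> /eqP->]|N1]; first by rewrite eqxx.
case: ifP => [/andP[/eqP-> /eqP->]|N2]; first by rewrite setUC eqxx.
rewrite IHp //; case: eqP => //= /setP E; exfalso.
have := E x; have := E y; rewrite !inE !eqxx ?orbT /=.
case/orP=> /eqP yE /orP[] /eqP xE; subst; move: N1 N2 xy; rewrite !eqxx //.
Qed.

Lemma path_edges_cat x p q :
  path_edges x (p ++ q) = path_edges x p ++ path_edges (last x p) q.
Proof. exact: pairmap_cat. Qed.

Lemma path_edges_sub E x p (e : {set V}) :
  path (edge_rel E) x p -> e \in path_edges x p -> e \in E.
Proof.
elim: p x => //= y p IHp x /andP[Exy pth]; rewrite in_cons => /predU1P[->//|].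
exact: IHp.
Qed.

Lemma path_edges_in x p e v : e \in path_edges x p -> v \in e -> v \in x :: p.
Proof.
elim: p x => //= y p IHp x; rewrite in_cons => /predU1P[->|pe ve].
  by rewrite !inE => /orP[]/eqP->; rewrite eqxx ?orbT.
by rewrite in_cons IHp ?orbT.
Qed.

Lemma path_edges_uniq x p : uniq (x :: p) -> uniq (path_edges x p).
Proof.
elim: p x => //= y p IHp x /andP[xp uniq_p]; rewrite IHp // andbT.
by apply: contraNN xp => /path_edges_in; apply; rewrite !inE eqxx.
Qed.

Lemma connect_path_edges x p : connect (edge_rel [set:: path_edges x p]) x (last x p).
Proof.
elim: p x => [|y p IHp] x /=; first exact: connect0.
apply: (@connect_trans _ _ y); first by apply: connect1; rewrite /= !inE eqxx.
apply: connect_edgeS (IHp y); apply/subsetP=> e; rewrite !inE => ->; exact: orbT.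
Qed.

Lemma excessD f g v : excess (fun u v => f u v + g u v) v = excess f v + excess g v.
Proof. exact: big_split. Qed.

(** By antisymmetry the sum over the pairs inside [R] is its own opposite, so only the flow leaving
    [R] remains. *)
Lemma sum_excess E f R : is_flow E f ->
  \sum_(u in R) excess f u = \sum_(u in R) \sum_(v in ~: R) f u v.
Proof.
move=> flow_f; have -> : \sum_(u in R) excess f u =
    \sum_(u in R) \sum_(v in R) f u v + \sum_(u in R) \sum_(v in ~: R) f u v.
  rewrite -big_split; apply: eq_bigr => u _; rewrite /excess (bigID (mem R)) /=.
  by congr (_ + _); apply: eq_bigl => v; rewrite inE.
suff -> : \sum_(u in R) \sum_(v in R) f u v = 0 by rewrite add0r.
set s := \sum_(u in R) _; suff : s = - s by lia.
rewrite /s {1}exchange_big /= -sumrN; apply: eq_bigr => u _.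
by rewrite -sumrN; apply: eq_bigr => v _; case: (flow_f v u).
Qed.

(** Here [r] consists of residual arcs: the path flow is positive only on arcs that the path
    traverses, where [f] leaves room for one more unit. *)
Lemma is_flowD_path E f (r : rel V) x p : is_flow E f ->
    (forall u v, r u v -> ([set u; v] \in E) && (f u v < 1)) ->
    path r x p -> uniq (x :: p) ->
  is_flow E (fun u v => f u v + path_flow x p u v).
Proof.
move=> flow_f rP pth uniq_p u v; have [anti le1 supp] := flow_f u v; split.
- by rewrite anti path_flow_anti opprD.
- have := path_flow_le1 u v uniq_p; have := @path_flow_gt0 r x p u v pth uniq_p.
  case: (ltrP 0 (path_flow x p u v)) => [pf /(_ isT)/rP/andP[_]|]; lia.
have [f0|/supp //] := eqVneq (f u v) 0; rewrite f0 add0r.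
rewrite neq_lt path_flow_anti oppr_lt0 => /orP[|]; last first.
  by rewrite -path_flow_anti => /(path_flow_gt0 pth uniq_p)/rP/andP[].
by move=> /(path_flow_gt0 pth uniq_p)/rP/andP[]; rewrite setUC.
Qed.

Lemma uniq_connect (r : rel V) x y : connect r x y ->
  exists p, [/\ path r x p, uniq (x :: p) & last x p = y].
Proof. by case/connectP=> p /shortenP[q pth uniq_q _] ->; exists q. Qed.

(** The augmentation step of Ford and Fulkerson. If residual arcs lead from [c] to [Z], a unit is
    pushed; otherwise every edge leaving the set reached from [c] is saturated, and the cut has as
    many edges as the net flow out of it. *)
Lemma augment E f c (Z : {pred V}) : is_flow E f ->
  (exists s g, [/\ s \in Z, is_flow E g &
      forall v, excess g v = excess f v + (v == c)%:Z - (v == s)%:Z])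
  \/ (exists R, [/\ c \in R, forall v, v \in R -> v \notin Z &
      (#|cut_arcs E R|)%:Z = \sum_(u in R) excess f u]).
Proof.
move=> flow_f; pose r u v := ([set u; v] \in E) && (f u v < 1).
have [/existsP[s /andP[Zs cs]]|noZ] := boolP [exists s, (s \in Z) && connect r c s].
  left; have [p [pth uniq_p lastp]] := uniq_connect cs.
  exists s, (fun u v => f u v + path_flow c p u v); split=> // [|v].
    exact: is_flowD_path pth uniq_p.
  by rewrite excessD excess_path_flow lastp addrA.
right; exists [set v | connect r c v]; split.
- by rewrite inE connect0.
- move=> v; rewrite inE => cv; apply: contraNN noZ => Zv.
  by apply/existsP; exists v; rewrite Zv.
rewrite (sum_excess _ flow_f) pair_big_dep /= -sum1_card.
rewrite (big_morph Posz PoszD (erefl _)) big_mkcond [RHS]big_mkcond.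
apply: eq_bigr => -[u v] _; rewrite !inE /=.
have [cu|] //= := boolP (connect r c u); have [|cv] //= := boolP (connect r c v).
have [_ le1 supp] := flow_f u v; case: ifP => Euv.
  have : ~~ (f u v < 1).
    by apply: contraNN cv => fuv; apply: (connect_trans cu); apply: connect1; rewrite /r Euv.
  by lia.
by apply/esym/eqP/negPn/negP=> /supp; rewrite Euv.
Qed.

(** Following the flow backwards from the sink [t] leads to a source. Adding the path flow out of
    [t] cancels the unit carried towards [t], so the edges of the path leave the support. *)
Lemma peel E f t : is_flow E f -> excess f t < 0 ->
  exists p, [/\ path (edge_rel E) t p, uniq (t :: p), 0 < excess f (last t p)
    & is_flow (E :\: [set:: path_edges t p]) (fun u v => f u v + path_flow t p u v)].
Proof.
move=> flow_f ft; pose r u v := f v u == 1.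
have rE u v : r u v -> [set u; v] \in E.
  by move=> /eqP fvu; have [_ _] := flow_f v u; rewrite fvu setUC; apply.
have [s /andP[ts fs]] : exists s, connect r t s && (0 < excess f s).
  (* Otherwise no flow enters the set [R] reached from [t], so its total excess is nonnegative,
     although it contains no source and [t] is a sink. *)
  apply/existsP; apply: contraTT ft => /existsPn noS; rewrite -leNgt.
  pose R := [set v | connect r t v].
  have Rt : t \in R by rewrite inE connect0.
  have : 0 <= \sum_(u in R) excess f u.
    rewrite (sum_excess _ flow_f); apply: sumr_ge0 => u; rewrite inE => tu.
    apply: sumr_ge0 => v; rewrite !inE => tv.
    have [anti _ _] := flow_f u v; have [_ le1 _] := flow_f v u.
    have : f v u != 1; last by lia.
    by apply: contraNN tv => fvu; apply: (connect_trans tu); apply: connect1.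
  rewrite (bigD1 t) //=; set s := \sum_(i in R | _) _ => le0.
  suff : s <= 0 by move: le0; lia.
  apply: sumr_le0 => u /andP[]; rewrite inE => tu _.
  by have := noS u; rewrite tu /= -leNgt.
have [p [pth uniq_p lastp]] := uniq_connect ts.
exists p; split=> //; [exact: sub_path pth | by rewrite lastp |].
have flow_g : is_flow E (fun u v => f u v + path_flow t p u v).
  apply: is_flowD_path pth uniq_p => // u v ruv; rewrite rE //=.
  by have [-> _ _] := flow_f u v; rewrite (eqP ruv).
move=> u v; have [anti le1 supp] := flow_g u v; split=> // g0.
rewrite in_setD supp // andbT inE -path_flow_neq0 //; apply: contraNN g0 => p0.
have [antif _ _] := flow_f u v; have pf1 := path_flow_le1 u v uniq_p.
have pf1' := path_flow_le1 v u uniq_p.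
have antip := path_flow_anti t p u v.
(* Whichever way the path crosses this pair, [f] carries one unit against it, and the sum is 0. *)
have : 0 < path_flow t p u v \/ 0 < path_flow t p v u.
  by move: p0; rewrite neq_lt => /orP[|->]; [right; lia | left].
case=> pf; have := path_flow_gt0 pth uniq_p pf; rewrite /r => /eqP; lia.
Qed.

Definition linked E c (tp : V * seq V) :=
  [&& path (edge_rel E) tp.1 tp.2, uniq (tp.1 :: tp.2) & last tp.1 tp.2 == c].

(** Flow decomposition, by induction on the list of sinks: a peeled path ends at [c], the only
    possible source, and takes one unit and its own edges away. An entry equal to [c] demands
    nothing and gets the empty path. *)
Lemma flow_paths E f c T : is_flow E f ->
    (forall v, excess f v = \sum_(t <- T) ((v == c)%:Z - (v == t)%:Z)) ->
  exists L, [/\ map fst L = T, all (linked E c) L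
    & uniq (flatten [seq path_edges tp.1 tp.2 | tp <- L])].
Proof.
elim: T E f => [|t T IHT] E f flow_f exf; first by exists [::].
have [tE|tc] := eqVneq t c.
  have [|L [<- Llink Luniq]] := IHT E f flow_f.
    by move=> v; rewrite exf big_cons tE subrr add0r.
  by exists ((t, [::]) :: L); split=> //=; rewrite Llink /linked /= tE eqxx.
have ft : excess f t < 0.
  rewrite exf big_cons eqxx (negPf tc).
  set s := \sum_(_ <- _) _; suff : s <= 0 by lia.
  by apply: sumr_le0 => j _; lia.
have [p [pth uniq_p lastp flow_g]] := peel flow_f ft.
have lastc : last t p = c.
  apply/eqP; apply: contraTT lastp => /negPf lastp; rewrite -leNgt exf.
  by apply: sumr_le0 => j _; rewrite lastp; lia.
have [|L [<- Llink Luniq]] := IHT _ _ flow_g.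
  by move=> v; rewrite excessD exf big_cons excess_path_flow lastc; set s := \sum_(_ <- _) _; lia.
exists ((t, p) :: L); split=> //=.
  rewrite {1}/linked /= lastc eqxx pth /= in uniq_p *; rewrite uniq_p /=.
  apply: sub_all Llink => -[s q] /and3P[/= qth uniq_q lastq].
  rewrite /linked /= in uniq_q *; rewrite uniq_q lastq !andbT.
  by apply: sub_path qth => u v /=; rewrite inE => /andP[].
rewrite cat_uniq Luniq path_edges_uniq // andbT /=.
apply/hasPn=> e /flattenP[_ /mapP[[s q] Lq ->]] /= qe.
have /and3P[/= qth _ _] := allP Llink _ Lq.
by have := path_edges_sub qth qe; rewrite !inE => /andP[].
Qed.

End Flows.

(** * Augmentation along a path system *)

Section FlowSums.
Variable V : finType.
Implicit Types (E : {set {set V}}) (f g : V -> V -> int).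
Local Open Scope ring_scope.

Lemma is_flow0 E : is_flow E (fun _ _ => 0).
Proof. by move=> u v; rewrite oppr0 eqxx. Qed.

Lemma is_flowN E f : is_flow E f -> is_flow E (fun u v => - f u v).
Proof.
move=> flow_f u v; have [anti le1 supp] := flow_f u v; have [_ le1' _] := flow_f v u.
split; [by rewrite anti | lia |].
by rewrite oppr_eq0.
Qed.

Lemma is_flowD_disjoint E E1 E2 f g : is_flow E1 f -> is_flow E2 g ->
  [disjoint E1 & E2] -> E1 \subset E -> E2 \subset E -> is_flow E (fun u v => f u v + g u v).
Proof.
move=> flow_f flow_g dis /subsetP sE1 /subsetP sE2 u v.
have [antif le1f suppf] := flow_f u v; have [antig le1g suppg] := flow_g u v.
have f0g0 : f u v = 0 \/ g u v = 0.
  have [->|/suppf Ef] := eqVneq (f u v) 0; first by left.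
  right; apply/eqP/negPn/negP=> /suppg Eg.
  by move/pred0P: dis => /(_ [set u; v]) /=; rewrite Ef Eg.
split; first by rewrite antif antig opprD.
  by case: f0g0 => ->; rewrite ?add0r ?addr0.
by case: f0g0 => ->; rewrite ?add0r ?addr0; [move/suppg/sE2 | move/suppf/sE1].
Qed.

Lemma is_flow_path (x : V) p : uniq (x :: p) -> is_flow [set:: path_edges x p] (path_flow x p).
Proof.
move=> uniq_p u v; split; [exact: path_flow_anti | exact: path_flow_le1 |].
by rewrite path_flow_neq0 // inE.
Qed.

End FlowSums.

(** The path is cut at both vertices, in whichever order they come; [p2] is the piece between
    them. *)
Lemma split_path2 (V : eqType) (a : V) P s w : s \in a :: P -> w \in a :: P ->
  exists p1 p2 p3, P = p1 ++ p2 ++ p3 /\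
    ((last a p1 = s /\ last a (p1 ++ p2) = w) \/ (last a p1 = w /\ last a (p1 ++ p2) = s)).
Proof.
case/splitPl=> p q lastp; rewrite -cat_cons mem_cat => /orP[wp|wq].
  case/splitPl: wp lastp => p1 p2 lastp1 lastp; exists p1, p2, q; rewrite catA; split=> //.
  by right; split.
have {wq} : w \in s :: q by rewrite inE wq orbT.
case/splitPl=> p2 p3 lastp2; exists p, p2, p3; split=> //; left; split=> //.
by rewrite last_cat lastp.
Qed.

Section Augmentation.
Variables (V : finType) (E : {set {set V}}) (a b c : V) (l : nat).
Implicit Types (B X : seq (seq V)) (Q : seq (seq V * V)) (T : seq V).

Definition used_edges B : seq {set V} := flatten [seq path_edges a p | p <- B].

Lemma used_edges_cons p B : used_edges (p :: B) = path_edges a p ++ used_edges B.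
Proof. by []. Qed.

Definition path_system B := all (fun p => linked E b (a, p)) B && uniq (used_edges B).

Lemma perm_used_edges B B' : perm_eq B B' -> perm_eq (used_edges B) (used_edges B').
Proof. by move=> BB'; apply/perm_flatten/perm_map. Qed.

Lemma perm_path_system B B' : perm_eq B B' -> path_system B = path_system B'.
Proof.
move=> BB'; rewrite /path_system (perm_all _ BB').
by rewrite (perm_uniq (perm_used_edges BB')).
Qed.

Lemma perm_used_set B B' : perm_eq B B' -> [set:: used_edges B] = [set:: used_edges B'].
Proof.
by move=> BB'; apply/setP=> e; rewrite !inE (perm_mem (perm_used_edges BB')).
Qed.

Local Open Scope ring_scope.

(** The excess of a flow that carries one unit from [c] to each entry of [T]. *)
Definition demand T v : int := \sum_(t <- T) ((v == c)%:Z - (v == t)%:Z).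

(* X lists a-b paths; Q lists a-b paths with a vertex where a path from c is to
   be attached; f is a flow from c to these vertices and y times to a and b. *)
Definition state X Q y f := [/\ path_system (X ++ map fst Q),
  all (fun q => q.2 \in a :: q.1) Q,
  (size X + size Q + y = l)%N,
  is_flow (E :\: [set:: used_edges (X ++ map fst Q)]) f &
  forall v, excess f v = demand (map snd Q ++ nseq y a ++ nseq y b) v].

Lemma sum_demand T (R : {set V}) : c \in R -> (forall t, t \in T -> t \notin R) ->
  \sum_(u in R) demand T u = (size T)%:Z.
Proof.
move=> Rc; rewrite exchange_big /=; elim: T => [|t T IHT] TR; first by rewrite big_nil.
rewrite big_cons IHT; last by move=> s Ts; apply: TR; rewrite inE Ts orbT.
rewrite (bigD1 c) //= eqxx big1; last first.
  move=> u /andP[Ru /negPf->]; suff /negPf-> : u != t by [].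
  by apply: contraTneq Ru => ->; apply/TR/mem_head.
have /negPf-> : c != t by apply: contraTneq Rc => ->; apply/TR/mem_head.
lia.
Qed.

(** The value of the flow is [size Q + y.*2], and a blocked augmentation would exhibit a cut with
    only that many edges. *)
Lemma augment_state X Q y f :
    (forall R : {set V}, c \in R -> a \notin R -> (l <= #|cut_arcs E R|)%N) ->
    state X Q y f -> (size Q + y.*2 < l)%N ->
  exists X' Q' y' f', state X' Q' y' f' /\ (size Q' + y'.*2 = (size Q + y.*2).+1)%N.
Proof.
move=> cutP [sysB wQ sizeB flow_f exf] klt.
set B := X ++ _ in sysB flow_f; set T := _ ++ _ in exf.
have [/allP Blink Buniq] := andP sysB.
pose Z := [pred v | has (fun p => v \in a :: p) B].
have ZB p v : p \in B -> v \in a :: p -> v \in Z by move=> Bp pv; apply/hasP; exists p.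
(* If no path were left, [y] would equal [l], against [size Q + y.*2 < l]. *)
have [p0 Bp0] : exists p, p \in B.
  have : (0 < size B)%N by rewrite size_cat size_map; lia.
  by case: (B) => // p s _; exists p; apply: mem_head.
have Za : a \in Z by apply: (ZB p0) => //; apply: mem_head.
have Zb : b \in Z.
  by apply: (ZB p0) => //; have /and3P[_ _ /= /eqP<-] := Blink _ Bp0; apply: mem_last.
have ZT t : t \in T -> t \in Z.
  rewrite !mem_cat !mem_nseq => /or3P[/mapP[q Qq ->]|/andP[_ /eqP->]|/andP[_ /eqP->]] //.
  apply: (ZB q.1); last exact: (allP wQ).
  by rewrite mem_cat map_f ?orbT.
case: (augment c Z flow_f) => [[s [g [Zs flow_g exg]]]|[R [Rc RZ cutR]]]; last first.
  have Ra : a \notin R by apply/negP=> /RZ; rewrite Za.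
  have := cutP R Rc Ra; suff -> : #|cut_arcs E R| = (size Q + y.*2)%N by lia.
  (* No vertex of the path system is in [R], so no used edge leaves [R]. *)
  have -> : cut_arcs E R = cut_arcs (E :\: [set:: used_edges B]) R.
    apply/setP=> -[u v]; rewrite !inE /=; case Ru: (u \in R) => //=; congr (_ && _).
    suff -> : [set u; v] \notin used_edges B by [].
    apply/negP=> /flattenP[_ /mapP[p Bp ->]] /path_edges_in/(_ (set21 _ _)) pu.
    by have := RZ u Ru; rewrite (ZB p).
  apply/eqP; rewrite -eqz_nat cutR (eq_bigr _ (fun u _ => exf u)) sum_demand //.
    by rewrite !size_cat size_map !size_nseq -addnn.
  by move=> t /ZT Zt; apply: contraL Zt; apply: RZ.
case/hasP: Zs => p; rewrite mem_cat => /orP[Xp|/mapP[[q w] Qq /= ->{p}]] ps.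
  have permX := perm_to_rem Xp; have permB : perm_eq B (rem p X ++ p :: map fst Q).
    by apply/permP=> P; rewrite !count_cat (permP permX P) /= addnCA addnA.
  (* The path [p] becomes a tripod with attachment vertex [s]. *)
  exists (rem p X), ((p, s) :: Q), y, g; split; last by rewrite /= addSn.
  split.
  - by rewrite -(perm_path_system permB).
  - by rewrite /= ps.
  - by move: (perm_size permX) sizeB => /= ->; clear; lia.
  - by rewrite -(perm_used_set permB).
  move=> v; rewrite exg exf /demand /= big_cons; set S := \sum_(_ <- _) _; clear; lia.
have permQ := perm_to_rem Qq; set Q1 := rem _ Q in permQ.
have permB : perm_eq B (q :: (X ++ map fst Q1)).
  by apply/permP=> P; rewrite count_cat (permP (perm_map fst permQ) P) /= count_cat addnCA.
have wq : w \in a :: q by apply: (allP wQ _ Qq).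
have [p1 [p2 [p3 [qE ends]]]] := split_path2 ps wq.
set s1 := last a p1 in ends; set s2 := last a (p1 ++ p2) in ends.
move: sysB; rewrite (perm_path_system permB) /path_system -cat1s all_cat all_seq1.
case/andP=> /andP[/and3P[qpath quniq /eqP qlast] Blink1].
rewrite cat1s used_edges_cons cat_uniq => /and3P[_ /hasPn qB Buniq1].
rewrite /= in qpath qlast.
(* The two units arriving at [s] and [w] continue along the outer pieces of [q], back to [a] along
   [p1] and on to [b] along [p3]; the middle piece [p2] is given up. *)
pose h := fun u v => (g u v + - path_flow a p1 u v) + path_flow s2 p3 u v.
exists X, Q1, y.+1, h; split; last first.
  by rewrite (perm_size permQ) /=; clear; lia.
have uniq1 : uniq (a :: p1) by move: quniq; rewrite qE -cat_cons cat_uniq => /andP[].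
have uniq3 : uniq (s2 :: p3).
  move: quniq; rewrite qE catA -cat_cons lastI cat_rcons cat_uniq.
  by case/and3P.
have edgesq : path_edges a q = path_edges a p1 ++ path_edges s1 p2 ++ path_edges s2 p3.
  by rewrite qE !path_edges_cat /s2 last_cat.
split.
- by rewrite /path_system Blink1.
- by apply/allP=> t Q1t; apply: (allP wQ); apply: mem_rem Q1t.
- by move: (perm_size permQ) sizeB => /= ->; clear; lia.
- move: flow_g; rewrite (perm_used_set permB) => flow_g.
  (* Removing [q] from the system frees its edges. The flow did not use them before, and [p1] and
     [p3] have no edge in common, so the three flows have disjoint supports. *)
  have sqE : {subset path_edges a q <= E :\: [set:: used_edges (X ++ map fst Q1)]}.
    move=> e qe; rewrite !inE (path_edges_sub qpath qe) andbT.
    by apply: contraTN qe; apply: qB.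
  have disq e : e \in path_edges a q ->
      e \notin E :\: [set:: used_edges (q :: (X ++ map fst Q1))].
    by move=> qe; rewrite !inE used_edges_cons mem_cat qe.
  have : uniq (path_edges a p1 ++ (path_edges s1 p2 ++ path_edges s2 p3)).
    by rewrite -edgesq path_edges_uniq.
  rewrite cat_uniq => /and3P[_ /hasPn dis13 _].
  have flow1 := is_flowN (is_flow_path uniq1); have flow3 := is_flow_path uniq3.
  pose E1 := (E :\: [set:: used_edges (q :: (X ++ map fst Q1))]) :|: [set:: path_edges a p1].
  apply: (is_flowD_disjoint (E1 := E1)) flow3 _ _ _.
  + apply: is_flowD_disjoint flow_g flow1 _ (subsetUl _ _) (subsetUr _ _).
    apply/pred0P=> e /=; apply/negP=> /andP[+ e1]; apply/negP/disq.
    by move: e1; rewrite inE edgesq mem_cat => ->.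
  + apply/pred0P=> e /=; apply/negP=> /andP[+ e3]; rewrite inE in e3.
    rewrite in_setU => /orP[|e1].
      by apply/negP/disq; rewrite edgesq !mem_cat e3 !orbT.
    have := dis13 e; rewrite mem_cat e3 orbT => /(_ isT)/negP; apply.
    by rewrite inE in e1.
  + apply/subsetP=> e; rewrite in_setU => /orP[|e1].
      rewrite !inE used_edges_cons mem_cat negb_or => /andP[/andP[_ ->]] ->; by [].
    by apply: sqE; move: e1; rewrite inE edgesq mem_cat => ->.
  + by apply/subsetP=> e e3; apply: sqE; move: e3; rewrite inE edgesq !mem_cat => ->; rewrite !orbT.
have excessN k v : excess (fun u v => - path_flow a k u v) v = - excess (path_flow a k) v.
  by rewrite /excess sumrN.
have lasts2 : last s2 p3 = b by rewrite -qlast qE catA last_cat.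
move=> v; rewrite !excessD excessN !excess_path_flow lasts2 exg exf -/s1.
rewrite /demand /T (perm_big _ (perm_cat (perm_map snd permQ) (perm_refl _))).
have nseqS (x : V) : nseq y.+1 x = x :: nseq y x by [].
rewrite map_cons !nseqS !(big_cat, big_cons) [(q, w).2]/=.
set S1 := \sum_(_ <- map _ _) _; set S2 := \sum_(_ <- nseq y a) _; set S3 := \sum_(_ <- nseq y b) _.
by case: ends => -[-> ->] /=; clear; lia.
Qed.

End Augmentation.

(** * Lists of edge lists *)

Section ZipCat.
Variable T : Type.
Implicit Types (A B : seq (seq T)).

Definition zipcat A B := [seq p.1 ++ p.2 | p <- zip A B].

Lemma size_zipcat A B : size (zipcat A B) = minn (size A) (size B).
Proof. by rewrite size_map size_zip. Qed.

(** Bounds on multiplicities serve both the disjointness of connectors and the inclusion of their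
    edges. Equality may fail because [zip] truncates the longer list. *)
Lemma count_zipcat (P : pred T) A B :
  count P (flatten (zipcat A B)) <= count P (flatten A) + count P (flatten B).
Proof.
elim: A B => [|s A IHA] [|s' B] //=; rewrite !count_cat.
by have := IHA B; rewrite /zipcat; lia.
Qed.

Lemma all_zipcat (P Q R : pred (seq T)) A B : (forall s s', P s -> Q s' -> R (s ++ s')) ->
  all P A -> all Q B -> all R (zipcat A B).
Proof.
move=> PQR; elim: A B => [|s A IHA] [|s' B] //= /andP[Ps PA] /andP[Qs QB].
by rewrite PQR //; apply: IHA.
Qed.

End ZipCat.

Lemma count_uniqP (T : eqType) (s : seq T) : reflect (forall x, count_mem x s <= 1) (uniq s).
Proof.
apply: (iffP idP) => [s_uniq x|s_count]; first by rewrite count_uniq_mem ?leq_b1.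
apply: count_mem_uniq => x; have := s_count x; rewrite -has_pred1 has_count.
by case: (count_mem x s) => [|[|k]].
Qed.

Lemma uniq_flatten_disjoint (T : eqType) (F : seq (seq T)) i j :
    uniq (flatten F) -> i < size F -> j < size F -> i != j ->
  forall x, x \in nth [::] F i -> x \notin nth [::] F j.
Proof.
move=> F_uniq; wlog ij : i j / i < j.
  move=> H iF jF; rewrite neq_ltn => /orP[] lt x xi; first by apply: H xi; rewrite ?ltn_eqF.
  by apply: contraTN xi; apply: H; rewrite // ltn_eqF.
elim: F i j F_uniq ij => // s F IHF [|i] [|j] //=; rewrite cat_uniq => /and3P[_ /hasPn sF uF].
  move=> _ _ jF _ x xs; apply: contraTN xs => xj; apply: sF.
  by apply/flattenP; exists (nth [::] F j); rewrite ?mem_nth.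
by move=> ij iF jF _; apply: IHF => //; rewrite ltn_eqF.
Qed.

Lemma map_eq_cat (T1 T2 : Type) (f : T1 -> T2) L A B : map f L = A ++ B ->
  exists L1 L2, [/\ L = L1 ++ L2, map f L1 = A & map f L2 = B].
Proof.
move=> LE; exists (take (size A) L), (drop (size A) L).
by rewrite cat_take_drop map_take map_drop LE take_size_cat // drop_size_cat.
Qed.

(** * Packing connectors of three terminals *)

Section Packing.
Variables (V : finType) (E : {set {set V}}) (a b c : V).
Implicit Types (s : seq {set V}).

(** Max-flow min-cut for source [b] and sink [a], one unit at a time: a blocked flow gives a cut
    with as many edges as its value. *)
Lemma flow_to_terminal l :
    (forall R : {set V}, b \in R -> a \notin R -> l <= #|cut_arcs E R|) ->
  exists f, is_flow E f /\ forall v, excess f v = demand b (nseq l a) v.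
Proof.
elim: l => [|l IHl] cutP.
  exists (fun _ _ => 0%R); split; first exact: is_flow0.
  by move=> v; rewrite /demand big_nil /excess big1.
have [|f [flow_f exf]] := IHl; first by move=> R Rb Ra; apply/ltnW/cutP.
case: (augment b (pred1 a) flow_f) => [[s [g [/eqP-> flow_g exg]]]|[R [Rb RZ cutR]]].
  exists g; split=> // v; rewrite exg exf /demand.
  have -> : nseq l.+1 a = a :: nseq l a by [].
  by rewrite big_cons -addrA addrC.
have Ra : a \notin R by apply/negP=> /RZ; rewrite inE eqxx.
have := cutP R Rb Ra; suff -> : #|cut_arcs E R| = l by rewrite ltnn.
apply/eqP; rewrite -eqz_nat cutR (eq_bigr _ (fun u _ => exf u)) sum_demand ?size_nseq //.
by move=> t; rewrite mem_nseq => /andP[_ /eqP->].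
Qed.

(** The edge version of Menger's theorem. The flow runs from [b] to [a] because [flow_paths] lists
    paths that start at the sinks. *)
Lemma path_system_exists l :
    (forall R : {set V}, b \in R -> a \notin R -> l <= #|cut_arcs E R|) ->
  exists2 X, path_system E a b X & size X = l.
Proof.
move=> /flow_to_terminal[f [flow_f exf]].
have [L [LT Llink Luniq]] := flow_paths flow_f exf.
have LE : L = [seq (a, p) | p <- map snd L].
  rewrite -map_comp -[LHS]map_id; apply/eq_in_map => -[t p] /= /(map_f fst).
  by rewrite LT mem_nseq => /andP[_ /eqP /= ->].
exists (map snd L); last by rewrite size_map -(size_map fst) LT size_nseq.
apply/andP; split; first by move: Llink; rewrite {1}LE all_map.
by move: Luniq; rewrite {1}LE -map_comp.
Qed.

Lemma augmented_state l k :
    (forall R : {set V}, b \in R -> a \notin R -> l <= #|cut_arcs E R|) ->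
    (forall R : {set V}, c \in R -> a \notin R -> l <= #|cut_arcs E R|) ->
    k <= l ->
  exists X Q y f, state E a b c l X Q y f /\ size Q + y.*2 = k.
Proof.
move=> cutb cutc; elim: k => [_|k IHk kl].
  have [X sysX sizeX] := path_system_exists cutb.
  exists X, [::], 0, (fun _ _ => 0%R); split=> //; split=> //.
  - by rewrite cats0.
  - by rewrite sizeX !addn0.
  by move=> v; rewrite /demand big_nil /excess big1.
have [X [Q [y [f [st kE]]]]] := IHk (ltnW kl).
have [|X' [Q' [y' [f' [st' kE']]]]] := augment_state cutc st; first by rewrite kE.
by exists X', Q', y', f'; rewrite kE' kE.
Qed.

Definition joins x y s := connect (edge_rel [set:: s]) x y.

Lemma joins_catl x y s s' : joins x y s -> joins x y (s ++ s').
Proof. by apply: connect_edgeS; apply/subsetP=> e; rewrite !inE mem_cat => ->. Qed.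

Lemma joins_catr x y s s' : joins x y s' -> joins x y (s ++ s').
Proof. by apply: connect_edgeS; apply/subsetP=> e; rewrite !inE mem_cat orbC => ->. Qed.

Lemma joins_sym x y s : joins x y s = joins y x s.
Proof. exact: connect_edgeC. Qed.

Lemma joins_trans y x z s : joins x y s -> joins y z s -> joins x z s.
Proof. exact: connect_trans. Qed.

Lemma joins_path x p : joins x (last x p) (path_edges x p).
Proof. exact: connect_path_edges. Qed.

Lemma joins_path_mem x p w : w \in x :: p -> joins x w (path_edges x p).
Proof.
case/splitPl=> p1 p2 <-; rewrite path_edges_cat; exact/joins_catl/joins_path.
Qed.

Definition joins3 s := joins a b s && joins a c s.

Lemma joins3P s : joins3 s ->
  {in [set a; b; c] &, forall x y, connect (edge_rel [set:: s]) x y}.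
Proof.
case/andP=> ab ac x y Sx Sy; have aS z : z \in [set a; b; c] -> joins a z s.
  rewrite !inE => /orP[/orP[]|] /eqP-> //; exact: connect0.
by apply: (@joins_trans a); [rewrite joins_sym aS | rewrite aS].
Qed.

(* The final state has q tripods and y paths between each two terminals, with
   q + 2y = 2n; two paths of different kinds form a connector. *)
Lemma connectors_exist n :
    (forall R : {set V}, b \in R -> a \notin R -> n.*2 <= #|cut_arcs E R|) ->
    (forall R : {set V}, c \in R -> a \notin R -> n.*2 <= #|cut_arcs E R|) ->
  exists F : seq (seq {set V}), [/\ n + n./2 <= size F, uniq (flatten F),
    {subset flatten F <= E} & all joins3 F].
Proof.
move=> cutb cutc.
have [X [Q [y [f [[sysB wQ sizeB flow_f exf] kE]]]]] := augmented_state cutb cutc (leqnn _).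
have [L [LT Llink Luniq]] := flow_paths flow_f exf.
have [L1 [L' [LE L1T /map_eq_cat[La [Lb [L'E LaT LbT]]]]]] := map_eq_cat LT.
subst L' L; move: Llink; rewrite !all_cat => /and3P[link1 linka linkb].
have [/allP linkB uniqB] := andP sysB.
pose pe (tp : V * seq V) := path_edges tp.1 tp.2.
pose Xe := map (path_edges a) X.
(* [L1] lists the flow paths at the attachment vertices in the order of [Q], so zipping gives each
   tripod its own third leg. *)
pose M := [seq path_edges a qt.1.1 ++ pe qt.2 | qt <- zip Q L1].
(* [X], [La] and [Lb] have [y] members each. Cutting the lists at [t] yields [t] pairs from [X] and
   [La], [t] from [X] and [Lb], and [y - t] from [La] and [Lb]. With the [q] tripods this makes
   [q + y + t], which is at least [n + n./2] since [q + 2y = 2n]. *)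
pose Ae := map pe La; pose Be := map pe Lb; pose t := y./2.
pose F := M ++ zipcat (take t Xe) (take t Ae) ++ zipcat (drop t Xe) (take t Be)
  ++ zipcat (drop t Ae) (drop t Be).
have take_drop (P : pred {set V}) (s : seq (seq {set V})) :
    count P (flatten (take t s)) + count P (flatten (drop t s)) = count P (flatten s).
  by rewrite -count_cat -flatten_cat cat_take_drop.
have countM P : count P (flatten M) <=
    count P (used_edges a (map fst Q)) + count P (flatten (map pe L1)).
  rewrite /M /used_edges; move: (L1) => L0.
  elim: (Q) L0 => [|q Q' IHQ] [|tp L0] //=.
  by rewrite !count_cat addnACA leq_add2l IHQ.
have countF P : count P (flatten F) <= count P (used_edges a (X ++ map fst Q))
    + count P (flatten (map pe (L1 ++ La ++ Lb))).
  have := countM P; have := take_drop P Xe; have := take_drop P Ae; have := take_drop P Be.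
  have := count_zipcat P (take t Xe) (take t Ae).
  have := count_zipcat P (drop t Xe) (take t Be).
  have := count_zipcat P (drop t Ae) (drop t Be).
  rewrite /F /used_edges !map_cat !flatten_cat !count_cat -/Xe -/Ae -/Be; clear; lia.
have LE e : e \in flatten (map pe (L1 ++ La ++ Lb)) ->
    e \in E :\: [set:: used_edges a (X ++ map fst Q)].
  case/flattenP=> _ /mapP[tp Ltp ->].
  have : linked (E :\: [set:: used_edges a (X ++ map fst Q)]) c tp.
    by move: Ltp; rewrite !mem_cat => /or3P[] ?;
      [apply: (allP link1) | apply: (allP linka) | apply: (allP linkb)].
  by case/and3P=> pth _ _; apply: path_edges_sub.
exists F; split.
- have sizeX : size Xe = size X by rewrite size_map.
  have sizeA : size Ae = y by rewrite size_map -(size_map fst) LaT size_nseq.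
  have sizeBe : size Be = y by rewrite size_map -(size_map fst) LbT size_nseq.
  have size1 : size L1 = size Q by rewrite -(size_map fst) L1T size_map.
  rewrite !size_cat !size_zipcat !size_take_min !size_drop size_map size_zip.
  rewrite sizeX sizeA sizeBe size1 /t; move: sizeB kE; clear; lia.
- apply/count_uniqP=> e; apply: leq_trans (countF _) _.
  have /count_uniqP/(_ e) := Luniq; have /count_uniqP/(_ e) := uniqB.
  have [/LE|] := boolP (e \in flatten (map pe (L1 ++ La ++ Lb))).
    by rewrite !inE => /andP[/count_memPn-> _].
  by move/count_memPn->; rewrite addn0.
- move=> e; rewrite -has_pred1 has_count => /leq_trans/(_ (countF _)).
  rewrite addn_gt0 -!has_count !has_pred1 => /orP[|/LE]; last by rewrite !inE => /andP[].
  case/flattenP=> _ /mapP[p Bp ->]; have /and3P[pth _ _] := linkB p Bp.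
  exact: path_edges_sub.
have allX : all (joins a b) Xe.
  apply/allP=> _ /mapP[p Xp ->]; have /and3P[_ _ /eqP <-] : linked E b (a, p).
    by apply: linkB; rewrite mem_cat Xp.
  exact: joins_path.
have allL K x : all (linked (E :\: [set:: used_edges a (X ++ map fst Q)]) c) K ->
    map fst K = nseq y x -> all (joins x c) (map pe K).
  move=> /allP linkK KT; apply/allP=> _ /mapP[[u p] Kp ->].
  have /and3P[_ _ /eqP /= <-] := linkK _ Kp.
  have := map_f fst Kp; rewrite KT mem_nseq => /andP[_ /eqP /= ->].
  exact: joins_path.
have allA := allL _ _ linka LaT; have allB := allL _ _ linkb LbT.
have all_td (P : pred (seq {set V})) (K : seq (seq {set V})) :
    all P K -> all P (take t K) && all P (drop t K).
  by rewrite -all_cat cat_take_drop.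
have /andP[allX1 allX2] := all_td _ _ allX.
have /andP[allA1 allA2] := all_td _ _ allA.
have /andP[allB1 allB2] := all_td _ _ allB.
rewrite !all_cat; apply/and4P; split.
- apply/allP=> _ /mapP[[q [u p]] Qqp ->] /=.
  have [Qq L1p uE] : [/\ q \in Q, (u, p) \in L1 & u = q.2].
    elim: (Q) (L1) L1T Qqp {linkB wQ} => [|q' Q' IHQ] [|tp' L0] //= [tpE L0T].
    rewrite inE => /predU1P[[-> tp'E]|/(IHQ _ L0T)[Qq L0p uE]].
      by rewrite !inE tp'E !eqxx -tpE -tp'E.
    by split; rewrite // inE ?Qq ?L0p orbT.
  have /and3P[_ _ /eqP /= lastq] : linked E b (a, q.1).
    by apply: linkB; rewrite mem_cat map_f ?orbT.
  have /and3P[_ _ /eqP /= lastp] := allP link1 _ L1p.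
  apply/andP; split; first by rewrite -lastq; apply/joins_catl/joins_path.
  apply: (@joins_trans q.2); first exact/joins_catl/joins_path_mem/(allP wQ).
  by rewrite -uE -lastp; apply/joins_catr/joins_path.
- apply: all_zipcat allX1 allA1 => s s' ab ac.
  by rewrite /joins3 joins_catl // joins_catr.
- apply: all_zipcat allX2 allB1 => s s' ab bc.
  by rewrite /joins3 joins_catl // (joins_trans (joins_catl _ ab)) // joins_catr.
- apply: all_zipcat allA2 allB2 => s s' ac bc.
  rewrite /joins3 [joins a c _]joins_catl // andbT.
  by apply: (@joins_trans c); [exact: joins_catl | rewrite joins_sym joins_catr].
Qed.

End Packing.

(** * Cuts of line graphs *)

Section LineCuts.
Variable G : sgraph.
Hypothesis G_gt2 : 2 < #|G|.
Implicit Types (f g h : line_graph G) (R D : {set line_graph G}).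

Lemma edge_crossing (X : {set G}) (A : {set {set G}}) x y :
    x \in X -> y \notin X -> connect (edge_rel A) x y ->
  exists u v, [/\ u \in X, v \notin X & [set u; v] \in A].
Proof.
move=> Xx XNy /connectP[p pth yE]; move: XNy; rewrite yE {y yE}.
elim: p x Xx pth => [|z p IHp] x Xx /=; first by rewrite Xx.
case/andP=> Axz; have [Xz|XNz] := boolP (z \in X); first exact: IHp.
by exists x, z.
Qed.

(** With any third vertex [z], every tree connecting [x], [y] and [z] leaves [X] through an edge in
    [D], and edge-disjoint trees do so through different edges. *)
Lemma lambda3_le_cut (X : {set G}) D x y : x \in X -> y \notin X ->
    (forall f u v, u \in X -> v \notin X -> val f = [set u; v] -> f \in D) ->
  lambda3 G <= #|D|.
Proof.
move=> Xx XNy cutD; have xy : x != y by apply: contraNneq XNy => <-.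
have [z zN] : exists z, z \notin [set x; y].
  apply/existsP; apply: contraLR G_gt2 => /existsPn all2; rewrite -leqNgt.
  have := cards2 x y; rewrite xy => /= <-; apply/subset_leq_card/subsetP=> z _.
  by have := all2 z; rewrite negbK.
pose S := [set x; y; z]; have S3 : #|S| = 3.
  by rewrite /S setUC cardsU1 zN cards2 xy.
have [_ /(_ S S3) lle] := min3P (@lambda G) G_gt2; apply: leq_trans lle _.
have [F /andP[/forall_inP treeF /forall_inP disF] ->] := lambdaP S.
have hit T : T \in F -> exists f, (f \in D) && (val f \in T.2).
  move=> /treeF/and4P[/andP[/subsetP sTE _] /andP[_ conT] _ /subsetP sST].
  have Sx : x \in S by rewrite !inE eqxx.
  have Sy : y \in S by rewrite !inE eqxx orbT.
  have := forall_inP (forall_inP conT x (sST _ Sx)) y (sST _ Sy).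
  case/(edge_crossing Xx XNy) => u [v [Xu Xv Tuv]].
  by exists (Sub [set u; v] (sTE _ Tuv)); rewrite /= Tuv andbT; apply: (cutD _ u v).
(* A member of [D] serves as default value for [tau]; if [D] is empty, there is no tree at all. *)
have [f0 D0|D0] := pickP (mem D); last first.
  rewrite [#|D|]eq_card0 // leqn0 cards_eq0; apply/negPn/negP=> /set0Pn[T /hit[f /andP[Df _]]].
  by have := D0 f; rewrite /= Df.
pose tau (T : subgraph G) := odflt f0 [pick f | (f \in D) && (val f \in T.2)].
have tauP T : T \in F -> (tau T \in D) && (val (tau T) \in T.2).
  by rewrite /tau; case: pickP => // noD /hit[f]; rewrite noD.
have tau_inj : {in F &, injective tau}.
  move=> T T' FT FT' tauE; apply/eqP/negPn/negP=> TT'.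
  have := implyP (forall_inP (disF T FT) T' FT') TT'; apply/negP/set0Pn.
  exists (val (tau T)); have /andP[_ t1] := tauP T FT; have /andP[_ t2] := tauP T' FT'.
  by rewrite inE t1 tauE.
rewrite -(card_in_imset tau_inj); apply/subset_leq_card/subsetP=> _ /imsetP[T FT ->].
by case/andP: (tauP T FT).
Qed.

Definition incident R v := [set f in R | v \in val f].

Lemma incidentU R v : incident setT v = incident R v :|: incident (~: R) v.
Proof. by apply/setP=> f; rewrite !inE; case: (f \in R); rewrite ?orbF. Qed.

(** The edges at [v] form the cut around [[set v]]. *)
Lemma lambda3_le_degree R v : lambda3 G <= #|incident R v| + #|incident (~: R) v|.
Proof.
have [w wv] : exists w, w \notin [set v].
  apply/existsP; apply: contraLR G_gt2 => /existsPn all1; rewrite -leqNgt.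
  apply: (@leq_trans 1) => //; rewrite -(cards1 v); apply/subset_leq_card/subsetP=> z _.
  by have := all1 z; rewrite negbK.
apply: (@leq_trans #|incident setT v|).
  apply: (lambda3_le_cut (X := [set v]) (x := v) _ wv); first by rewrite inE.
  move=> f u u'; rewrite inE => /eqP-> _ fE.
  by rewrite inE fE !inE eqxx.
by rewrite (incidentU R) cardsU leq_subr.
Qed.

Definition mixed R v := (incident R v != set0) && (incident (~: R) v != set0).

Lemma incidentP R v : reflect (exists2 f, f \in R & v \in val f) (incident R v != set0).
Proof.
apply: (iffP (set0Pn _)) => [[f]|[f Rf fv]]; first by rewrite inE => /andP[]; exists f.
by exists f; rewrite inE Rf.
Qed.

(** Let [X] be the set of vertices other than [v] that meet [R]. An edge leaving [X] is in [R],
    since otherwise its end in [X] would be mixed; so its other end meets [R] too and can only be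
    [v]. *)
Lemma lambda3_le_incident R v x :
    (forall w, mixed R w -> w = v) -> incident R x != set0 -> x != v ->
  lambda3 G <= #|incident R v|.
Proof.
move=> mixv Rx xv; pose X := [set u | (u != v) && (incident R u != set0)].
apply: (lambda3_le_cut (X := X) (x := x) (y := v)); rewrite ?inE ?xv ?eqxx //.
move=> f u w; rewrite inE => /andP[uv Ru] wX fE.
have Rf : f \in R.
  apply: contraNT uv => RNf; apply/eqP/mixv; rewrite /mixed Ru.
  by apply/incidentP; exists f; rewrite ?inE // fE !inE eqxx.
rewrite inE Rf /=; move: wX; rewrite inE negb_and negbK => /orP[/eqP<-|].
  by rewrite fE !inE eqxx orbT.
by case/negP; apply/incidentP; exists f; rewrite // fE !inE eqxx orbT.
Qed.

Lemma mixedC R v : mixed (~: R) v = mixed R v.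
Proof. by rewrite /mixed setCK andbC. Qed.

(** All edges at [v] are adjacent in the line graph, so the part of the cut at [v] is complete
    bipartite and its size is a product. *)
Definition line_cut_at R v := setX (incident R v) (incident (~: R) v).

Lemma line_cut_at_sub R v : line_cut_at R v \subset cut_arcs (edges (line_graph G)) R.
Proof.
apply/subsetP=> -[f g] /setXP[]; rewrite !inE => /andP[Rf fv] /andP[Rg gv].
apply/and3P; split=> //=; rewrite (in_edges f g).
by apply: (line_adjI fv gv); apply: contraTneq Rf => ->.
Qed.

(** Two distinct edges of [G] share at most one vertex. *)
Lemma line_cut_at_disjoint R v w : v != w -> [disjoint line_cut_at R v & line_cut_at R w].
Proof.
move=> vw; apply/pred0P=> -[f g] /=; apply/negP=> /andP[/setXP[+ +] /setXP[+ +]]; rewrite !inE.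
move=> /andP[Rf fv] /andP[Rg gv] /andP[_ fw] /andP[_ gw]; case/negP: Rg.
suff <- : f = g by [].
apply/val_inj; rewrite (edge_pairP (valP f) fv fw vw).
by rewrite (edge_pairP (valP g) gv gw vw).
Qed.

Lemma other_end f v : exists2 w, w \in val f & w != v.
Proof.
have /edge_card2 f2 := valP f; have /card_gt0P[w] : 0 < #|val f :\ v|.
  by have := cardsD1 v (val f); rewrite f2; case: (v \in val f) => /= ?; lia.
by rewrite !inE => /andP[wv fw]; exists w.
Qed.

(** Let [m] be [lambda3 G]. The part of the cut at a mixed vertex has size [kj] with [k] and [j]
    positive and [k + j >= m], hence at least [m - 1]. Two mixed vertices give [2(m - 1)]; at a
    single one [k] and [j] are both at least [m]; and for [m > 1] there is one. *)
Lemma line_cut_ge R f g : f \in R -> g \notin R ->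
  (lambda3 G).-1.*2 <= #|cut_arcs (edges (line_graph G)) R|.
Proof.
move=> Rf RNg; have [m_le1|m_gt1] := leqP (lambda3 G) 1; first by lia.
have mixed_cut v : mixed R v -> (lambda3 G).-1 <= #|line_cut_at R v|.
  rewrite /mixed -!card_gt0 cardsX => /andP[]; have := lambda3_le_degree R v.
  move: #|incident R v| #|incident (~: R) v| => k j; nia.
have [/existsP[v mixv]|nomix] := boolP [exists v, mixed R v]; last first.
  have nomixed w : ~~ mixed R w by apply: contraNN nomix => mw; apply/existsP; exists w.
  have /card_gt0P[v0 _] : 0 < #|G| by apply: ltn_trans G_gt2.
  (* Without mixed vertices, the end [y] of [g] would meet at least [m] edges of [R] and so be
     mixed. *)
  have [y gy _] := other_end g v0; have [x fx xy] := other_end f y.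
  have Rx : incident R x != set0 by apply/incidentP; exists f.
  have : lambda3 G <= #|incident R y|.
    by apply: lambda3_le_incident Rx xy => w mw; case/negP: (nomixed w).
  move/(leq_trans (ltnW m_gt1)); rewrite card_gt0 => Ry; case/negP: (nomixed y).
  by rewrite /mixed Ry; apply/incidentP; exists g; rewrite ?inE.
have [/existsP[w /andP[mixw vw]]|onemix] := boolP [exists w, mixed R w && (v != w)].
  apply: (@leq_trans #|line_cut_at R v :|: line_cut_at R w|); last first.
    by apply: subset_leq_card; rewrite subUset !line_cut_at_sub.
  have /eqP -> : #|line_cut_at R v :|: line_cut_at R w| ==
      #|line_cut_at R v| + #|line_cut_at R w|.
    by rewrite (leq_card_setU _ _) line_cut_at_disjoint.
  by rewrite -addnn leq_add ?mixed_cut.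
have mixv1 w : mixed R w -> w = v.
  move=> mixw; apply/eqP/negPn/negP=> wv; case/negP: onemix.
  by apply/existsP; exists w; rewrite mixw eq_sym.
have mixv1' w : mixed (~: R) w -> w = v by rewrite mixedC; apply: mixv1.
have [x fx xv] := other_end f v; have [y gy yv] := other_end g v.
have Rx : incident R x != set0 by apply/incidentP; exists f.
have Ry : incident (~: R) y != set0 by apply/incidentP; exists g; rewrite ?inE.
apply: leq_trans (subset_leq_card (line_cut_at_sub R v)); rewrite cardsX.
have := lambda3_le_incident mixv1 Rx xv; have := lambda3_le_incident mixv1' Ry yv.
by move: m_gt1; move: #|incident R v| #|incident (~: R) v| => k j; nia.
Qed.

End LineCuts.

(** * Assembling the bounds *)

Lemma connectors_le_lambda (G : sgraph) (a b c : G) (F : seq (seq {set G})) :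
    uniq [:: a; b; c] -> uniq (flatten F) -> {subset flatten F <= edges G} ->
    all (joins3 a b c) F ->
  size F <= lambda [set a; b; c].
Proof.
move=> abc F_uniq FE F_joins.
have S_gt1 : 1 < #|[set a; b; c]|.
  apply/card_gt1P; exists a, b; split; rewrite ?inE ?eqxx ?orbT //.
  by move: abc; rewrite /= !inE negb_or => /andP[/andP[]].
rewrite -(card_ord (size F)) -cardsT.
have inF (i : 'I_(size F)) : nth [::] F i \in F by apply: mem_nth.
apply: (@card_le_lambda _ _ S_gt1 _ setT (fun i : 'I_(size F) => [set:: nth [::] F i])).
- move=> i _; apply/subsetP=> e; rewrite inE => ie; apply: FE.
  by apply/flattenP; exists (nth [::] F i).
- by move=> i _; apply/joins3P/(allP F_joins).
move=> i j _ _ ij; apply/pred0P=> e /=; rewrite !inE.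
apply/negP=> /andP[ie]; apply/negP; exact: (uniq_flatten_disjoint (i := i)) ie.
Qed.

Lemma lambda3_line_ge (G : sgraph) : 2 < #|G| -> 2 < #|line_graph G| ->
  (lambda3 G).-1 + (lambda3 G).-1./2 <= lambda3 (line_graph G).
Proof.
move=> G_gt2 L_gt2; have [[S S3 lE] _] := min3P (@lambda (line_graph G)) L_gt2.
rewrite {3}/lambda3 lE; have [a [b [c [-> abc]]]] := cards3P S3.
have cut t (R : {set line_graph G}) : t \in R -> a \notin R ->
    (lambda3 G).-1.*2 <= #|cut_arcs (edges (line_graph G)) R|.
  exact: line_cut_ge.
have [F [sizeF F_uniq FE F_joins]] := connectors_exist (cut b) (cut c).
exact: leq_trans sizeF (connectors_le_lambda abc F_uniq FE F_joins).
Qed.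

(** In a graph with at most two vertices every edge is the whole vertex set, so there is at most
    one. *)
Lemma line_graph_gt2 (G : sgraph) : 2 < #|line_graph G| -> 2 < #|G|.
Proof.
apply: contraLR; rewrite -!leqNgt => G_le2.
apply: (@leq_trans 1) => //; apply/card_le1_eqP=> e f _ _; apply: val_inj.
have eT (g : line_graph G) : val g = setT.
  by apply/eqP; rewrite eqEcard subsetT cardsT (edge_card2 (valP g)).
by rewrite !eT.
Qed.

Theorem proposition5 (G : sgraph) (G_connected : connected G) :
  [/\ (2 < #|G|)%N -> (2 < #|line_graph G|)%N ->
        (lambda3 G <= kappa3 (line_graph G))%N,
      (2 < #|G|)%N -> (2 < #|line_graph G|)%N ->
        (3 / 2 * (lambda3 G)%:R - 2 <= (lambda3 (line_graph G))%:R :> rat)%R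
    & (2 < #|G|)%N -> (2 < #|line_graph (line_graph G)|)%N ->
        (3 / 2 * (kappa3 G)%:R - 2
           <= (kappa3 (line_graph (line_graph G)))%:R :> rat)%R].
Proof.
have rat_bound m k l : m <= k -> k.-1 + k.-1./2 <= l ->
    (3 / 2 * m%:R - 2 <= l%:R :> rat)%R.
  (* For [n = k - 1], twice [n + n./2] is at least [3n - 1], that is [3k - 4]; for [k = 0] the bound
     is trivial. *)
  move=> mk kl; have : 3 * m <= 2 * l + 4 by lia.
  rewrite -(ler_nat rat) natrD !natrM; lra.
split=> [||G_gt2 LL_gt2]; first exact: lambda3_le_kappa3_line.
  by move=> G_gt2 L_gt2; apply: rat_bound (leqnn _) (lambda3_line_ge G_gt2 L_gt2).
have L_gt2 := line_graph_gt2 LL_gt2.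
apply: rat_bound (kappa3_le_lambda3 G_gt2) _.
exact: leq_trans (lambda3_line_ge G_gt2 L_gt2) (lambda3_le_kappa3_line L_gt2 LL_gt2).
Qed.
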